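(* Let $n \in \mathbb{N}$. Then the monoid $UT_n(\mathbb{Z}_{\max})$ is minimally and irredundantly generated by $A(1) \cup \{-1\cdot I_n\} \cup E(0) \cup A(-\infty)$, where $$A(1) = \{A_i(1) : 1 \le i \le n\},\quad E(0) = \{E_{ij} : 1 \le i < j \le n\},\quad A(-\infty) = \{A_i(-\infty) : 1 \le i \le n\}.$$
   Context: $\mathbb{N}$ is the set of positive integers. $\mathbb{Z}_{\max} = \mathbb{Z}\cup\{-\infty\}$ is the tropical integer semiring, with semiring addition $\max$ and semiring multiplication the usual addition; its semiring zero is $-\infty$ and its semiring one is $0$. $UT_n(\mathbb{Z}_{\max})$ is the monoid, under (tropical) matrix multiplication, of $n\times n$ matrices over $\mathbb{Z}_{\max}$ with all entries below the diagonal equal to $-\infty$. $A_i(\lambda)$ is the $n\times n$ matrix with $\lambda$ in position $(i,i)$, $0$ in all other diagonal positions, and $-\infty$ off the diagonal. For $i<j$, $E_{ij}$ is the $n \times n$ matrix with diagonal entries $0$, $(i,j)$ entry $0$, and all other entries $-\infty$. $-1\cdot I_n$ is the matrix with the integer $-1$ in every diagonal position and $-\infty$ elsewhere. A subset $X$ of a semigroup $\mathcal{S}$ is a generating set if $\mathcal{S}$ is the smallest subsemigroup containing $X$. It is minimal if $|X|\le |Y|$ for every generating set $Y$ of $\mathcal{S}$, and irredundant if for each $x\in X$, $X \setminus\{x\}$ is not a generating set. ''Minimally and irredundantly generated by $X$'' means $X$ is a minimal and irredundant generating set. *)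

(* Defs.v *)
From HB Require Import structures.
From mathcomp Require Import all_boot all_order all_algebra.
From mathcomp Require Import boolp classical_sets functions cardinality.
Set Implicit Arguments.
Unset Strict Implicit.
Unset Printing Implicit Defensive.
Import Order.TTheory GRing.Theory Num.Theory.
Local Open Scope ring_scope.
Local Open Scope classical_set_scope.
Local Open Scope card_scope.

Section Generation.
Context {S : semigroupType}.
Implicit Types X Y A : set S.

Definition subsemigroup A : Prop := forall x y, A x -> A y -> A (x * y)%g.

Definition generating_set X : Prop := smallest subsemigroup X = [set: S].

Definition minimal_generating_set X : Prop :=
  generating_set X /\ forall Y, generating_set Y -> X #<= Y.

Definition irredundant_generating_set X : Prop :=
  generating_set X /\ forall x, X x -> ~ generating_set (X `\ x).

Definition minimally_irredundantly_generated_by X : Prop :=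
  minimal_generating_set X /\ irredundant_generating_set X.

End Generation.

(* [None] is -oo. Beware that in the semiring structure below [0 : Zmax] is
   -oo and [1 : Zmax] is the integer 0; elements are therefore written with
   [Zfin] and [Zninf] when they are meant as numbers. *)
Definition Zmax : Type := option int.
Definition Zfin (z : int) : Zmax := Some z.
Definition Zninf : Zmax := None.

HB.instance Definition _ := Choice.on Zmax.

Definition Zmax_add (x y : Zmax) : Zmax :=
  match x, y with
  | Some a, Some b => Zfin (Num.max a b)
  | None, _ => y
  | _, None => x
  end.

Definition Zmax_mul (x y : Zmax) : Zmax :=
  match x, y with
  | Some a, Some b => Zfin (a + b)
  | _, _ => Zninf
  end.

Fact Zmax_addA : associative Zmax_add.
Proof. by case=> [a|] [b|] [c|] //=; rewrite maxA. Qed.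

Fact Zmax_addC : commutative Zmax_add.
Proof. by case=> [a|] [b|] //=; rewrite maxC. Qed.

Fact Zmax_add0 : left_id Zninf Zmax_add.
Proof. by case. Qed.

HB.instance Definition _ :=
  GRing.isNmodule.Build Zmax Zmax_addA Zmax_addC Zmax_add0.

Fact Zmax_mulA : associative Zmax_mul.
Proof. by case=> [a|] [b|] [c|] //=; rewrite addrA. Qed.

Fact Zmax_mulC : commutative Zmax_mul.
Proof. by case=> [a|] [b|] //=; rewrite addrC. Qed.

Fact Zmax_mul1 : left_id (Zfin 0) Zmax_mul.
Proof. by case=> [a|] //=; rewrite add0r. Qed.

Fact Zmax_mulDl : left_distributive Zmax_mul Zmax_add.
Proof. by case=> [a|] [b|] [c|] //=; rewrite addr_maxl. Qed.

Fact Zmax_mul0 : left_zero Zninf Zmax_mul.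
Proof. by []. Qed.

Fact Zmax_oner_neq0 : Zfin 0 != Zninf.
Proof. by []. Qed.

HB.instance Definition _ := GRing.Nmodule_isComNzSemiRing.Build Zmax
  Zmax_mulA Zmax_mulC Zmax_mul1 Zmax_mulDl Zmax_mul0 Zmax_oner_neq0.

Section UpperTriangular.
Variable n : nat.
Implicit Types (M N : 'M[Zmax]_n) (i j : 'I_n).

Definition is_upper_trig M : bool :=
  [forall i : 'I_n, forall j : 'I_n, (j < i)%N ==> (M i j == Zninf)].

Lemma is_upper_trigP M :
  reflect (forall i j, (j < i)%N -> M i j = Zninf) (is_upper_trig M).
Proof.
apply: (iffP forallP) => [H i j ji|H i].
  by apply/eqP; move/forallP: (H i) => /(_ j)/implyP; apply.
by apply/forallP => j; apply/implyP => ji; apply/eqP/H.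
Qed.

Record UT : Type := MkUT { UTval : 'M[Zmax]_n; UTvalP : is_upper_trig UTval }.

HB.instance Definition _ := [isSub for UTval].
HB.instance Definition _ := [Choice of UT by <:].

Fact is_upper_trig_mul M N :
  is_upper_trig M -> is_upper_trig N -> is_upper_trig (M *m N).
Proof.
move=> /is_upper_trigP HM /is_upper_trigP HN; apply/is_upper_trigP => i j ji.
rewrite mxE big1 // => k _; case: (ltnP k i) => [ki|ik].
  by rewrite HM // mul0r.
by rewrite HN ?mulr0 // (leq_trans ji).
Qed.

Fact is_upper_trig_diag M :
  (forall i j, i != j -> M i j = Zninf) -> is_upper_trig M.
Proof.
move=> H; apply/is_upper_trigP => i j ji; apply: H.
by rewrite neq_ltn ji orbT.
Qed.

Fact scalar_mx_upper (l : Zmax) : is_upper_trig l%:M.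
Proof. by apply: is_upper_trig_diag => r c /negPf rc; rewrite mxE rc. Qed.

Definition UT_mul (M N : UT) : UT :=
  MkUT (is_upper_trig_mul (UTvalP M) (UTvalP N)).

Definition UT_scalar (l : Zmax) : UT := MkUT (scalar_mx_upper l).

Definition UT_one : UT := UT_scalar 1.

Fact UT_mulA : associative UT_mul.
Proof. by move=> M N P; apply/val_inj/mulmxA. Qed.

Fact UT_mul1 : left_id UT_one UT_mul.
Proof. by move=> M; apply/val_inj/mul1mx. Qed.

Fact UT_mulr1 : right_id UT_one UT_mul.
Proof. by move=> M; apply/val_inj/mulmx1. Qed.

HB.instance Definition _ := isMonoid.Build UT UT_mulA UT_mul1 UT_mulr1.

Definition A_mx (i : 'I_n) (l : Zmax) : 'M[Zmax]_n :=
  \matrix_(r, c) if r == c then (if r == i then l else Zfin 0) else Zninf.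

Definition E_mx (i j : 'I_n) : 'M[Zmax]_n :=
  \matrix_(r, c)
    if (r == c) || ((r == i) && (c == j)) then Zfin 0 else Zninf.

Fact A_mx_upper i l : is_upper_trig (A_mx i l).
Proof. by apply: is_upper_trig_diag => r c /negPf rc; rewrite mxE rc. Qed.

Fact E_mx_upper i j : (i < j)%N -> is_upper_trig (E_mx i j).
Proof.
move=> ij; apply/is_upper_trigP => r c cr; rewrite mxE.
case: eqP => [rc|_] /=; first by rewrite rc ltnn in cr.
by case: andP => // -[/eqP ri /eqP cj]; move: cr; rewrite ri cj ltnNge ltnW.
Qed.

Definition UT_A i l : UT := MkUT (A_mx_upper i l).

Definition UT_E i j (ij : (i < j)%N) : UT := MkUT (E_mx_upper ij).

Definition A_set (l : Zmax) : set UT := [set UT_A i l | i in [set: 'I_n]].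

Definition E_set : set UT :=
  [set M | exists (i j : 'I_n) (ij : (i < j)%N), M = UT_E ij].

End UpperTriangular.

Arguments UT_scalar : clear implicits.
Arguments A_set : clear implicits.
Arguments E_set : clear implicits.

(* Main.v *)
Require Import Defs.
From mathcomp Require Import all_boot all_order all_algebra.
From mathcomp Require Import boolp classical_sets functions cardinality.
From mathcomp Require Import zify.
Import Order.TTheory GRing.Theory Num.Theory.
Local Open Scope ring_scope.
Local Open Scope classical_set_scope.

Set Implicit Arguments.
Unset Strict Implicit.
Unset Printing Implicit Defensive.

(** Write 0 for -oo and 1 for the integer 0, the zero and the one of Zmax.

    Generation.  The exponent vectors of the invertible diagonal matrices
    obtained from A(1) and -1.I_n form a subsemigroup of Z^n containing the unit
    vectors e_i and -(1, ..., 1), hence all of Z^n.  Conjugating E_ij by such a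
    diagonal matrix puts any integer at (i, j), and A_i(-oo) supplies the zero
    diagonal entry; so every elementary matrix, that is the identity with one
    entry on or above the diagonal replaced, is generated.  An upper triangular
    matrix is a product of elementary ones: at its first entry, column by column
    and top to bottom, that differs from the identity, it is the product of the
    matrix with this entry reset by an elementary matrix ([mul_elementary]),
    so one inducts on the number of such entries ([closed_upper_trig]).

    Minimality.  Everything rests on an invariant, the [defect] of a matrix: the
    set of positions of the zeros of its diagonal if there are any, and
    otherwise the set of positions of its nonzero entries above the diagonal.
    The units are the matrices of empty defect; E_ij has defect {(i, j)} and
    A_i(-oo) has defect {(i, i)}.  A product of defect {p} has a factor of
    defect {p} ([defect1_mul]), so a generating set contains an element of
    defect {p} for every p = (i, j) with i <= j.  A product is a unit only if
    its factors are ([defect0_mul]), so the units of a generating set generate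
    the group of units, which is Z^n through the diagonal exponents.  This takes n + 1 of
    them: at most n generators would form a basis of Q^n, and the negative of
    one of them would not be a nonnegative combination
    ([nonneg_spanning_size]).  The resulting lower bound
    (n + 1) + n (n + 1) / 2 is the number of the given generators.

    Irredundancy.  A finite generating set of least cardinality is irredundant
    ([finite_minimal_irredundant]). *)

(** * Generating sets of semigroups *)

Section SemigroupGeneration.
Variable S : semigroupType.
Implicit Types X Y A : set S.

Lemma generating_setP X :
  generating_set X <->
  (forall A, subsemigroup A -> X `<=` A -> forall x, A x).
Proof.
split=> [genX A mulA XA x|ind].
  have : smallest subsemigroup X x by rewrite genX.
  by move=> inX; exact: inX (conj mulA XA).
by apply/seteqP; split=> // x _ A [mulA XA]; exact: ind A mulA XA x.
Qed.

(** The complement of a property that passes from a product to one of its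
    factors is a subsemigroup; a generating set lying in it would force every
    element to lack the property. *)
Lemma generator_with_prime_property X (P : S -> Prop) x :
  generating_set X -> P x ->
  (forall y z, P (y * z)%g -> P y \/ P z) -> exists2 y, X y & P y.
Proof.
move=> /generating_setP genX Px PM; apply: contrapT => noXP.
suff /genX /(_ _ x) : subsemigroup [set y | ~ P y].
  by apply=> // y Xy Py; apply: noXP; exists y.
by move=> y z nPy nPz /PM [].
Qed.

Lemma finite_minimal_irredundant X :
  finite_set X -> minimal_generating_set X -> irredundant_generating_set X.
Proof.
move=> finX [genX minX]; split=> // x Xx /minX.
have finXx : finite_set (X `\ x) by exact: finite_setD.
move=> leX; have : (X #= X `\ x)%card by rewrite card_eq_le leX card_le_setD.
move=> /(fcard_eq finX finXx); rewrite fset_setD1 // (finmap.cardfsD1 x).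
by rewrite in_fset_set // mem_set // => /eqP; rewrite add1n gtn_eqF.
Qed.

End SemigroupGeneration.

(** * Tropical scalars and the defect of a matrix *)

Section TropicalEntries.
Implicit Types x y : Zmax.

Lemma Zmax_addr_eq0 x y : (x + y == 0) = (x == 0) && (y == 0).
Proof. by case: x y => [a|] [b|]. Qed.

Lemma Zmax_mulr_eq0 x y : (x * y == 0) = (x == 0) || (y == 0).
Proof. by case: x y => [a|] [b|]. Qed.

Lemma ZfinM (a b : int) : Zfin a * Zfin b = Zfin (a + b).
Proof. by []. Qed.

(** There is no cancellation in Zmax, so one nonzero term suffices. *)
Lemma Zmax_sumr_neq0 (I : finType) (f : I -> Zmax) i :
  f i != 0 -> \sum_k f k != 0.
Proof.
by move=> fi; rewrite (bigD1 i) //= Zmax_addr_eq0 negb_and fi.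
Qed.

End TropicalEntries.

Section UpperTriangular.
Variable n : nat.
Implicit Types (M N : UT n) (i j : 'I_n) (p : 'I_n * 'I_n).

Lemma UT_lower M i j : (j < i)%N -> UTval M i j = 0.
Proof. exact: (is_upper_trigP _ (UTvalP M)). Qed.

Lemma UT_mulE M N i j :
  UTval (M * N)%g i j = \sum_k UTval M i k * UTval N k j.
Proof. by rewrite mxE. Qed.

Lemma UT_mul_diagE M N i :
  UTval (M * N)%g i i = UTval M i i * UTval N i i.
Proof.
rewrite UT_mulE (bigD1 i) //= big1 ?addr0 // => k.
rewrite neq_ltn => /orP[ki|ik]; first by rewrite (UT_lower _ ki) mul0r.
by rewrite (UT_lower N ik) mulr0.
Qed.

Definition full_diag M := [forall k, UTval M k k != 0].

(** The case distinction makes products of defect {p} behave like prime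
    elements: if the diagonal of the product is full, the nonzero entries of the
    factors survive in it; if not, each zero on that diagonal comes from a
    factor, whatever the entries above the diagonal. *)
Definition defect M : {set 'I_n * 'I_n} :=
  if full_diag M
  then [set p : 'I_n * 'I_n | (p.1 < p.2)%N && (UTval M p.1 p.2 != 0)]%SET
  else [set p : 'I_n * 'I_n | (p.1 == p.2) && (UTval M p.1 p.2 == 0)]%SET.

Lemma full_diagM M N : full_diag (M * N)%g = full_diag M && full_diag N.
Proof.
apply/forallP/andP => [H|[/forallP HM /forallP HN] k]; last first.
  by rewrite UT_mul_diagE Zmax_mulr_eq0 negb_or HM HN.
by split; apply/forallP => k; have := H k;
  rewrite UT_mul_diagE Zmax_mulr_eq0 negb_or => /andP[].
Qed.

Lemma defect0_full M : defect M = finset.set0 -> full_diag M.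
Proof.
move=> M0; apply/negPn/negP => Mnf; have := Mnf; rewrite negb_forall.
case/existsP=> k; rewrite negbK => Mk.
have := finset.in_set0 (k, k).
by rewrite -M0 /defect (negPf Mnf) inE /= eqxx Mk.
Qed.

(** If P has a nonzero diagonal, multiplying by P keeps a nonzero entry nonzero,
    because the term through the diagonal of P is nonzero. *)
Lemma defect_sub_mul M N : full_diag (M * N)%g ->
  (defect M \subset defect (M * N)%g) && (defect N \subset defect (M * N)%g).
Proof.
move=> fMN; have := fMN; rewrite full_diagM => /andP[fM fN].
apply/andP; split; apply/fintype.subsetP => -[i j];
  rewrite /defect fMN ?fM ?fN !inE /= => /andP[-> nz]; rewrite /= UT_mulE.
  apply: (Zmax_sumr_neq0 (i := j)).
  by rewrite Zmax_mulr_eq0 negb_or nz (forallP fN).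
apply: (Zmax_sumr_neq0 (i := i)).
by rewrite Zmax_mulr_eq0 negb_or nz (forallP fM).
Qed.

(** A matrix of empty defect is an invertible diagonal matrix, so this says that
    the units form a group whose complement is an ideal. *)
Lemma defect0_mul M N :
  defect (M * N)%g = finset.set0 <->
  defect M = finset.set0 /\ defect N = finset.set0.
Proof.
split=> [MN0|[M0 N0]].
  have := defect_sub_mul (defect0_full MN0).
  by rewrite MN0 !finset.subset0 => /andP[/eqP-> /eqP->].
have fM := defect0_full M0; have fN := defect0_full N0.
have off P i j : defect P = finset.set0 -> i != j -> UTval P i j = 0.
  move=> P0; rewrite neq_ltn => /orP[ij|]; last exact: UT_lower.
  have := finset.in_set0 (i, j).
  rewrite -P0 /defect (defect0_full P0) inE /= ij /=.
  by move/negbFE/eqP.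
apply/finset.setP => -[i j].
rewrite finset.in_set0 /defect full_diagM fM fN inE /=.
apply/negP => /andP[ij /eqP]; apply; rewrite UT_mulE big1 // => k _.
have [<-|ik] := eqVneq i k; last by rewrite (off M) ?mul0r.
by rewrite (off N) ?mulr0 // neq_ltn ij.
Qed.

(** With a full diagonal both factors have defect inside {p}, and not both are
    units.  Otherwise p = (i, i): the factor responsible for the zero at (i, i)
    has no other zero on its diagonal, since the product has none. *)
Lemma defect1_mul M N p : defect (M * N)%g = [set p]%SET ->
  defect M = [set p]%SET \/ defect N = [set p]%SET.
Proof.
move=> MNp; have [fMN|nfMN] := boolP (full_diag (M * N)%g).
  have := defect_sub_mul fMN; rewrite MNp !finset.subset1 => /andP[].
  move=> /orP[/eqP|/eqP M0]; first by left.
  move=> /orP[/eqP|/eqP N0]; first by right.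
  have MN0 : defect (M * N)%g = finset.set0 by apply/defect0_mul.
  by have := finset.set11 p; rewrite -MNp MN0 finset.in_set0.
have inD q : (q.1 == q.2) && (UTval (M * N)%g q.1 q.2 == 0) = (q == p).
  by have := congr1 (fun D : {set _} => q \in D) MNp;
    rewrite /= /defect (negPf nfMN) !inE.
case: p inD {MNp nfMN} => i i' inD.
have := inD (i, i'); rewrite eqxx /= => /andP[/eqP e]; rewrite -{}e in inD *.
rewrite UT_mul_diagE Zmax_mulr_eq0.
have main P : (forall k, UTval P k k == 0 -> UTval (M * N)%g k k == 0) ->
    UTval P i i == 0 -> defect P = [set (i, i)]%SET.
  move=> Psub Pi; have nfP : ~~ full_diag P.
    by rewrite negb_forall; apply/existsP; exists i; rewrite negbK.
  apply/finset.setP => -[k l]; rewrite /defect (negPf nfP) !inE /=.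
  apply/andP/eqP => [[/eqP <- /Psub Pk]|[-> ->]]; last by rewrite eqxx.
  by apply/eqP; rewrite -inD /= eqxx.
by case/orP=> [Mi|Ni]; [left|right]; apply: main => // k;
  rewrite UT_mul_diagE Zmax_mulr_eq0 => ->; rewrite ?orbT.
Qed.

Definition UT_diag (z : 'rV[int]_n) : UT n :=
  insubd (UT_one n) (diag_mx (map_mx Zfin z)).

Lemma UT_diagE z : UTval (UT_diag z) = diag_mx (map_mx Zfin z).
Proof.
rewrite [LHS]insubdK //; apply: is_upper_trig_diag => i j ij.
by rewrite !mxE (negPf ij).
Qed.

Lemma defect_diag z : defect (UT_diag z) = finset.set0.
Proof.
have fz : full_diag (UT_diag z).
  by apply/forallP => k; rewrite UT_diagE !mxE eqxx.
apply/finset.setP => -[i j].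
rewrite finset.in_set0 /defect fz inE /= UT_diagE !mxE.
by have [->|_] := eqVneq i j; rewrite ?ltnn // eqxx andbF.
Qed.

(** The default value at a zero diagonal entry is arbitrary: the exponents are
    used for matrices of empty defect. *)
Definition exponents M : 'rV[int]_n :=
  \row_i odflt 0 (UTval M i i : option int).

Lemma exponents_diag z : exponents (UT_diag z) = z.
Proof. by apply/rowP => i; rewrite mxE UT_diagE !mxE eqxx. Qed.

Lemma exponentsM M N : defect M = finset.set0 -> defect N = finset.set0 ->
  exponents (M * N)%g = exponents M + exponents N.
Proof.
move=> /defect0_full/forallP fM /defect0_full/forallP fN.
apply/rowP => i; rewrite [LHS]mxE UT_mul_diagE !mxE.
by have := fM i; have := fN i; case: (UTval M i i) (UTval N i i) => [a|] [b|].
Qed.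

Lemma defect_E i j (ij : (i < j)%N) : defect (UT_E ij) = [set (i, j)]%SET.
Proof.
have fE : full_diag (UT_E ij) by apply/forallP => k; rewrite mxE eqxx.
apply/finset.setP => -[k l]; rewrite /defect fE !inE mxE /= xpair_eqE.
have [->|_] := eqVneq k l; last first.
  by have [->|] := eqVneq k i; have [->|] := eqVneq l j; rewrite ?ij ?andbF.
rewrite ltnn; apply/esym/andP => -[/eqP ki /eqP kj].
by move: (ij); rewrite -ki kj ltnn.
Qed.

Lemma defect_A_ninf i : defect (UT_A i Zninf) = [set (i, i)]%SET.
Proof.
have nfA : ~~ full_diag (UT_A i Zninf).
  by rewrite negb_forall; apply/existsP; exists i; rewrite mxE !eqxx.
apply/finset.setP => -[k l]; rewrite /defect (negPf nfA) !inE mxE /= xpair_eqE.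
have [<-|kl] := eqVneq k l; first by rewrite andbb; case: (k == i).
by apply/esym/andP => -[/eqP ki /eqP li]; rewrite ki li eqxx in kl.
Qed.

End UpperTriangular.

(** * Spanning Z^n with nonnegative coefficients *)

(** Suppose m <= n.  The rows of V span Q^n, so they form a basis of it.  The
    only rational combination giving minus a row has coefficient -1 there. *)
Lemma nonneg_spanning_size m n (V : 'M[int]_(m, n)) : (0 < n)%N ->
  (forall z : 'rV[int]_n, exists w : 'rV[rat]_m,
     (forall k, 0 <= w 0 k) /\ map_mx intr z = w *m map_mx intr V) ->
  (n < m)%N.
Proof.
move=> n_gt0 span; rewrite ltnNge; apply/negP => mn.
pose W : 'M[rat]_(m, n) := map_mx intr V.
have rkW : \rank W = n.
  apply/eqP; rewrite eqn_leq rank_leq_col /= -[leqLHS](mxrank1 rat).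
  apply/mxrankS/row_subP => i; have [w [_ e]] := span (delta_mx 0 i).
  by rewrite row1 -(map_delta_mx intr) e submxMl.
have mE : m = n by apply/eqP; rewrite eqn_leq mn -{1}rkW rank_leq_row.
have m_gt0 : (0 < m)%N by rewrite mE.
pose k : 'I_m := Ordinal m_gt0.
have [w [w_ge0 e]] := span (- row k V).
have freeW : row_free W by rewrite /row_free rkW mE.
have : w = - delta_mx 0 k.
  by apply: (row_free_inj freeW); rewrite -e mulNmx -rowE map_mxN map_row.
by move=> /rowP/(_ k); rewrite !mxE !eqxx => wk; have := w_ge0 k; rewrite wk.
Qed.

(** * Lower bound for the size of a generating set *)

Section LowerBound.
Variables (n : nat) (n_gt0 : (0 < n)%N) (Y : set (UT n)).
Hypothesis genY : generating_set Y.

Lemma generator_with_defect M p : defect M = [set p]%SET ->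
  exists2 y, Y y & defect y = [set p]%SET.
Proof.
move=> Mp; apply: generator_with_prime_property genY Mp _ => P Q.
exact: defect1_mul.
Qed.

(** If s contained all the units of Y, the exponent vectors of s would span Z^n
    with nonnegative coefficients: for the units this property is stable under
    products, their exponents being additive. *)
Lemma new_unit_generator (s : seq (UT n)) : (size s <= n)%N ->
  exists y, [/\ Y y, defect y = finset.set0 & y \notin s].
Proof.
move=> sn; apply: contrapT => noy.
pose V := \matrix_(k < size s) exponents (nth 1%g s k).
suff : (n < size s)%N by rewrite ltnNge sn.
apply: (@nonneg_spanning_size _ _ V) => // z.
pose A := [set M | defect M = finset.set0 -> exists w : 'rV[rat]_(size s),
  (forall k, 0 <= w 0 k) /\ map_mx intr (exponents M) = w *m map_mx intr V].
suff : A (UT_diag z).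
  by rewrite -{2}(exponents_diag z); apply; exact: defect_diag.
have /generating_setP := genY; apply=> [M N AM AN /defect0_mul[M0 N0]|y Yy y0].
  have [[u [u_ge0 uE]] [v [v_ge0 vE]]] := (AM M0, AN N0).
  exists (u + v); split=> [k|]; first by rewrite mxE addr_ge0.
  by rewrite exponentsM // map_mxD uE vE mulmxDl.
have ys : y \in s by apply: contrapT => /negP ys; apply: noy; exists y.
have ks : (index y s < size s)%N by rewrite index_mem.
exists (delta_mx 0 (Ordinal ks)); split=> [k|]; first by rewrite mxE ler0n.
by rewrite -rowE -map_row rowK nth_index.
Qed.

Lemma unit_generators : exists s : seq (UT n),
  [/\ size s = n.+1, uniq s & {in s, forall y, Y y /\ defect y = finset.set0}].
Proof.
suff: forall k, (k <= n.+1)%N -> exists s : seq (UT n),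
  [/\ size s = k, uniq s & {in s, forall y, Y y /\ defect y = finset.set0}].
  by apply.
elim=> [|k IH] kn; first by exists [::].
have [s [sk us Ys]] := IH (ltnW kn).
have [|y [Yy y0 ys]] := @new_unit_generator s; first by rewrite sk.
exists (y :: s); split=> [|/=|x]; rewrite /= ?sk ?ys //.
by rewrite in_cons => /orP[/eqP->|/Ys].
Qed.

(** One index for each given generator: ['I_n.+1] for -1.I_n and the A_i(1), and
    the pairs i <= j, which are the possible singleton defects, for the E_ij and
    the A_i(-oo). *)
Definition generator_index : Type :=
  ('I_n.+1 + {p : 'I_n * 'I_n | (p.1 <= p.2)%N})%type.

(** Distinct indices yield distinct elements of Y because the defect tells them
    apart, except for the units, which are taken from a duplicate-free list. *)
Lemma index_le_generating : ([set: generator_index] #<= Y)%card.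
Proof.
have [s [ss us Ys]] := unit_generators.
have /choice[g gP] (p : {p : 'I_n * 'I_n | (p.1 <= p.2)%N}) :
    exists y : UT n, Y y /\ defect y = [set val p]%SET.
  case: p => -[i j] /= ij.
  have [M Mij] : exists M : UT n, defect M = [set (i, j)]%SET.
    move: ij; rewrite leq_eqVlt => /orP[/eqP/val_inj<-|ij].
      by exists (UT_A i Zninf); exact: defect_A_ninf.
    by exists (UT_E ij); exact: defect_E.
  by have [y Yy yE] := generator_with_defect Mij; exists y.
pose f (x : generator_index) :=
  match x with inl k => nth 1%g s k | inr p => g p end.
have sP (k : 'I_n.+1) : nth 1%g s k \in s by rewrite mem_nth // ss.
have injf : injective f.
  move=> [k|p] [l|q] //= e.
  - congr inl; apply/val_inj/eqP.
    by rewrite -(nth_uniq 1%g _ _ us) ?ss ?ltn_ord // e.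
  - have [_] := Ys _ (sP k); rewrite e (gP q).2 => q0.
    by have := finset.set11 (val q); rewrite q0 finset.in_set0.
  - have [_] := Ys _ (sP l); rewrite -e (gP p).2 => p0.
    by have := finset.set11 (val p); rewrite p0 finset.in_set0.
  - by congr inr; apply/val_inj/finset.set1_inj; rewrite -(gP p).2 e (gP q).2.
have := inj_card_eq (A := [set: generator_index]) (in2W injf).
rewrite card_eq_sym card_eq_le => /andP[leI _].
apply: card_le_trans leI _; apply: subset_card_le => _ [[k|p] _ <-] /=.
  by have [] := Ys _ (sP k).
by have [] := gP p.
Qed.

End LowerBound.

(** * Generation by elementary matrices *)

Section Generation.
Variable n : nat.
Implicit Types (X : 'M[Zmax]_n) (z : 'rV[int]_n) (i j : 'I_n).

Lemma UT_diagD y z : UT_diag (y + z) = (UT_diag y * UT_diag z)%g.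
Proof.
apply/val_inj; rewrite /= !UT_diagE mul_diag_mx; apply/matrixP => r c.
by rewrite !mxE; have [->|_] := eqVneq r c; rewrite ?mulr1n ?mulr0n ?mulr0.
Qed.

Lemma UT_A_diag i (a : int) :
  UT_A i (Zfin a) = UT_diag (a *: delta_mx 0 i).
Proof.
apply/val_inj; rewrite /= UT_diagE; apply/matrixP => r c; rewrite !mxE eqxx.
have [->|_] := eqVneq r c; rewrite ?mulr1n ?mulr0n //.
by case: (eqVneq c i) => _; rewrite ?mulr1 ?mulr0.
Qed.

Lemma UT_scalar_diag (a : int) : UT_scalar n (Zfin a) = UT_diag (const_mx a).
Proof.
by apply/val_inj; rewrite /= UT_diagE; apply/matrixP => r c; rewrite !mxE.
Qed.

Definition set_entry X i j (a : Zmax) : 'M[Zmax]_n :=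
  \matrix_(r, c) if (r == i) && (c == j) then a else X r c.

(** Right multiplication by the elementary matrix changes column j alone: for
    i < j it adds a times column i, a unit column, so that a is added to the
    zero at (i, j) and nowhere else; for i = j it scales column j, a unit column. *)
Lemma mul_elementary X i j a :
  (forall r, X r i = (1%:M : 'M[Zmax]_n) r i) ->
  X i j = (1%:M : 'M[Zmax]_n) i j ->
  X *m set_entry 1%:M i j a = set_entry X i j a.
Proof.
move=> Xi Xij; apply/matrixP => r c; rewrite !mxE.
have [->|cj] := eqVneq c j; last first.
  rewrite andbF (bigD1 c) //= !mxE (negPf cj) andbF eqxx mulr1.
  rewrite big1 ?addr0 // => k kc.
  by rewrite !mxE (negPf cj) andbF (negPf kc) mulr0.
rewrite andbT (bigD1 i) //= !mxE !eqxx /= Xi mxE.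
have [ij|ij] := eqVneq i j.
  rewrite big1 => [|k ki].
    have [_|ri] := eqVneq r i; rewrite ?mul1r ?mul0r addr0 //.
    by rewrite -ij Xi mxE (negPf ri).
  by rewrite !mxE (negPf ki) /= -ij (negPf ki) mulr0.
have ji : j != i by rewrite eq_sym.
rewrite (bigD1 j) //= !mxE (negPf ji) eqxx mulr1 big1 ?addr0; last first.
  by move=> k /andP[ki kj]; rewrite !mxE (negPf ki) (negPf kj) mulr0.
have [->|ri] := eqVneq r i; last by rewrite mul0r add0r.
by rewrite mul1r Xij mxE (negPf ij) addr0.
Qed.

Variable H : set (UT n).
Hypothesis mulH : subsemigroup H.
Hypothesis H_A1 : forall i, H (UT_A i (Zfin 1)).
Hypothesis H_scalar : H (UT_scalar n (Zfin (-1))).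
Hypothesis H_E : forall i j (ij : (i < j)%N), H (UT_E ij).
Hypothesis H_Aninf : forall i, H (UT_A i Zninf).

(** Every integer vector exceeds some -(b + 1)(1, ..., 1) by a nonnegative
    combination of the unit vectors. *)
Lemma closed_diag z : H (UT_diag z).
Proof.
have up x (y : 'rV[int]_n) :
    (forall i, 0 <= y 0 i) -> H (UT_diag x) -> H (UT_diag (x + y)).
  move=> y_ge0; rewrite [y]row_sum_delta; elim/big_ind: _ x.
  - by move=> x; rewrite addr0.
  - by move=> u v Hu Hv x Hx; rewrite addrA; apply/Hv/Hu.
  move=> i _ x; have := y_ge0 i; case: (y 0 i) => // k _.
  elim: k x => [|k IH] x Hx; first by rewrite scale0r addr0.
  rewrite intS scalerDl addrA; apply: IH.
  by rewrite UT_diagD -UT_A_diag; exact: mulH.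
have low k : H (UT_diag (const_mx (- k.+1%:Z))).
  elim: k => [|k IH]; first by rewrite -UT_scalar_diag.
  suff -> : const_mx (- k.+2%:Z) =
      const_mx (- k.+1%:Z) + const_mx (-1) :> 'rV_n.
    by rewrite UT_diagD; apply: mulH => //; rewrite -UT_scalar_diag.
  by apply/rowP => i; rewrite !mxE; lia.
(* In a semigroup the multiples of -(1, ..., 1) start at 1, hence b + 1. *)
pose b := (\sum_i `|z 0%R i|)%N.
rewrite -(subrKC (const_mx (- b.+1%:Z)) z); apply: up (low b) => i.
rewrite !mxE; have : (`|z 0%R i| <= b)%N by rewrite /b (bigD1 i) //= leq_addr.
by move: b (z 0 i) => b x; lia.
Qed.

(** For an integer a above the diagonal, conjugate E_ij by the diagonal matrix
    whose i-th entry is a: the diagonal is restored and the (i, j) entry becomes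
    a. *)
Lemma closed_elementary i j a : (i <= j)%N ->
  exists2 M, H M & UTval M = set_entry 1%:M i j a.
Proof.
rewrite leq_eqVlt => /orP[/eqP/val_inj<-|ij].
  exists (UT_A i a).
    by case: a => [a|//]; rewrite -/(Zfin a) UT_A_diag; exact: closed_diag.
  apply/matrixP => r c; rewrite !mxE; have [->|rc] := eqVneq r c.
    by rewrite andbb.
  by case: andP => // -[/eqP ri /eqP ci]; rewrite ri ci eqxx in rc.
case: a => [a|].
  pose d := a *: delta_mx 0 i : 'rV[int]_n.
  exists (UT_diag d * UT_E ij * UT_diag (- d))%g.
    by apply: mulH (closed_diag _); apply: mulH (H_E ij); exact: closed_diag.
  rewrite /= !UT_diagE mul_diag_mx mul_mx_diag; apply/matrixP => r c.
  have ji : (j == i) = false by rewrite -val_eqE gtn_eqF.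
  rewrite !mxE eqxx; have [->|ri] := eqVneq r i; have [->|cj] := eqVneq c j;
    rewrite /= ?orbT.
  - by rewrite ji !ZfinM mulr1 mulr0 oppr0 !addr0.
  - by case: (eqVneq i c) => _ //; rewrite !ZfinM !mulr1 addr0 subrr.
  - by rewrite mulr0 ji mulr0; case: (r == j).
  - rewrite mulr0; case: (eqVneq r c) => [<-|_] //.
    by rewrite (negPf ri) !ZfinM mulr0 oppr0 !addr0.
exists (UT_diag 0); first exact: closed_diag.
rewrite UT_diagE; apply/matrixP => r c; rewrite !mxE.
have [->|_] := eqVneq r c; last by case: ifP.
by case: andP => // -[/eqP ci /eqP cj]; move: (ij); rewrite -ci -cj ltnn.
Qed.

(** Let (i, j) be the first entry, column by column and top to bottom, differing
    from the identity.  Resetting it to the identity value gives X' satisfying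
    the hypotheses of [mul_elementary]: column i of X' is a unit column, either
    because i < j, or because i = j and X is triangular. *)
Lemma closed_upper_trig X : is_upper_trig X -> exists2 M, H M & UTval M = X.
Proof.
pose bad X :=
  [set p : 'I_n * 'I_n | X p.1 p.2 != (1%:M : 'M[Zmax]_n) p.1 p.2]%SET.
have [m] := ubnP #|bad X|; elim: m X => // m IH X badX /is_upper_trigP triX.
have [X1|[p0 p0X]] := set_0Vmem (bad X).
  exists (UT_diag 0); first exact: closed_diag.
  rewrite UT_diagE; apply/matrixP => r c; rewrite !mxE.
  by have := finset.in_set0 (r, c); rewrite -X1 inE /= mxE => /negbFE/eqP ->.
(* The weight j * n + i orders the positions (i, j) column by column. *)
have [[i j] /= ijX ijmin] := arg_minnP (P := fun p => p \in bad X)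
  (fun p : 'I_n * 'I_n => p.2 * n + p.1)%N p0X.
move: (ijX); rewrite inE /= => Xij.
have le_ij : (i <= j)%N.
  rewrite leqNgt; apply: contra Xij => ji.
  by rewrite triX // mxE -val_eqE gtn_eqF.
pose X' := set_entry X i j ((1%:M : 'M[Zmax]_n) i j).
have [||M HM ME] := IH X'.
- rewrite -ltnS; apply: leq_trans badX; rewrite ltnS; apply: proper_card.
  apply/fintype.properP; split; last first.
    by exists (i, j) => //; rewrite inE /= !mxE !eqxx.
  apply/fintype.subsetP => -[r c]; rewrite !inE /= !mxE.
  by case: andP => // -[/eqP-> /eqP->]; rewrite eqxx.
- apply/is_upper_trigP => r c cr; rewrite mxE triX //.
  by case: andP => // -[/eqP ri /eqP cj]; move: cr; rewrite ri cj ltnNge le_ij.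
have [E HE EE] := closed_elementary (X i j) le_ij.
exists (M * E)%g; first exact: mulH.
rewrite /= ME EE mul_elementary /X'.
- apply/matrixP => r c; rewrite !mxE.
  by case: andP => // -[/eqP-> /eqP->].
- move=> r; rewrite mxE; case: ifP => [/andP[/eqP-> /eqP<-]//|rij].
  apply/eqP/negPn/negP => Xri.
  have := ijmin (r, i); rewrite inE /= => /(_ Xri) le.
  have lt_ri : ~~ (i < r)%N.
    by apply: contra Xri => ir; rewrite triX // mxE -val_eqE gtn_eqF.
  have : ~~ ((r == i :> nat) && (i == j :> nat)) by rewrite !val_eqE rij.
  have := ltn_ord r; move: le le_ij lt_ri; clear; nia.
- by rewrite mxE !eqxx.
Qed.

End Generation.

(** * The generating set *)

Section GeneratorSet.
Variable n : nat.

Definition UT_generators : set (UT n) :=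
  A_set n (Zfin 1) `|` [set UT_scalar n (Zfin (-1))] `|` E_set n
    `|` A_set n Zninf.

Lemma UT_generators_generating : generating_set UT_generators.
Proof.
apply/generating_setP => A mulA genA M.
have [||||N AN /val_inj<- //] :=
  closed_upper_trig mulA _ _ _ _ (UTvalP M).
- by move=> i; apply: genA; left; left; left; exists i.
- by apply: genA; left; left; right.
- by move=> i j ij; apply: genA; left; right; exists i, j, ij.
- by move=> i; apply: genA; right; exists i.
Qed.

Definition generator_of_index (x : generator_index n) : UT n :=
  match x with
  | inl k => if unlift ord_max k is Some i then UT_A i (Zfin 1)
             else UT_scalar n (Zfin (-1))
  | inr p => if decP (@idP ((val p).1 < (val p).2)%N) is left ij then UT_E ij
             else UT_A (val p).1 Zninf
  end.

Lemma UT_generators_le_index :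
  (UT_generators #<= [set: generator_index n])%card.
Proof.
apply: card_le_trans (card_image_le generator_of_index _).
apply: subset_card_le => M [[[[i _ <-]|->]|[i [j [ij ->]]]]|[i _ <-]].
- by exists (inl (lift ord_max i)); rewrite //= liftK.
- by exists (inl ord_max); rewrite //= unlift_none.
- exists (inr (exist _ (i, j) (ltnW ij))) => //=.
  by case: decP => // ij'; rewrite (bool_irrelevance ij' ij).
- exists (inr (exist _ (i, i) (leqnn i))) => //=.
  by case: decP => // ii; have := ii; rewrite ltnn.
Qed.

End GeneratorSet.

Theorem corollary3p5 (n : nat) (n_gt0 : (0 < n)%N) :
  minimally_irredundantly_generated_by
    (A_set n (Zfin 1) `|` [set UT_scalar n (Zfin (-1))] `|` E_set n
       `|` A_set n Zninf).
Proof.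
have minX : minimal_generating_set (@UT_generators n).
  split=> [|Y genY]; first exact: UT_generators_generating.
  apply: card_le_trans (@UT_generators_le_index n) _.
  exact: index_le_generating.
split=> //; apply: finite_minimal_irredundant minX.
exact: card_le_finite (@UT_generators_le_index n) finite_finset.
Qed.
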